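(* Let $\mathcal{I}$ be an ideal on $\mathbb{N}$. (i) If $\mathcal{I}$ has the Baire property, then $\operatorname{L}_{\mathcal{I}}(\omega)\cup\{0\}$ contains a closed linear subspace of $\ell_\infty$ of density continuum. (ii) If $\mathcal{I}$ has the hereditary Baire property, then $\operatorname{L}_{\mathcal{I}}(\mathfrak{c})\cup\{0\}$ contains a closed linear subspace of $\ell_\infty$ of density continuum.
   Context: $\ell_\infty$ is the Banach space of bounded real sequences with the supremum norm. An ideal on $\mathbb{N}$ is a family of subsets of $\mathbb{N}$ closed under finite unions and subsets, not containing $\mathbb{N}$ and containing all singletons. For $x\in\ell_\infty$, a real $t$ is an $\mathcal{I}$-cluster point of $x$ if $\{n\in\mathbb{N}:|x(n)-t|<\varepsilon\}\notin\mathcal{I}$ for every $\varepsilon>0$. For a cardinal $\kappa$, $\operatorname{L}_{\mathcal{I}}(\kappa)$ is the set of all $x\in\ell_\infty$ having exactly $\kappa$ many $\mathcal{I}$-cluster points; $\omega$ is the countably infinite cardinal and $\mathfrak{c}$ the cardinality of the continuum. Identifying subsets of a countable set $X$ with their characteristic functions, an ideal on $X$ is a subset of $\{0,1\}^X$ (product topology); it has the Baire property if it does as a subset of $\{0,1\}^X$. For $X\notin\mathcal{I}$ put $\mathcal{I}\upharpoonright X=\{A\cap X:A\in\mathcal{I}\}$, an ideal on $X$. $\mathcal{I}$ has the hereditary Baire property if $\mathcal{I}\upharpoonright X$ has the Baire property (in $\{0,1\}^X$) for every $X\notin\mathcal{I}$. The density of a topological space is the least cardinality of a dense subset. *)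

(* Defs.v *)
From HB Require Import structures.
From mathcomp Require Import all_boot all_order all_algebra.
From mathcomp Require Import all_classical all_reals all_analysis.
Import Order.TTheory GRing.Theory Num.Theory.
Import numFieldNormedType.Exports.

Set Implicit Arguments.
Unset Strict Implicit.
Unset Printing Implicit Defensive.

Local Open Scope classical_set_scope.
Local Open Scope ring_scope.
Local Open Scope card_scope.

(** * The normed space of bounded real sequences *)

Section linfty.
Variable R : realType.

(* [R^o] is [R] as a module over itself, so that [nat -> R^o] is an
   [lmodType R]. *)
Definition bounded_seq : {pred nat -> R^o} :=
  mem (bounded_fun : set (nat -> R^o)).

Lemma bounded_seqP (u : nat -> R^o) :
  reflect (exists M, forall n, `|u n| <= M) (u \in bounded_seq).
Proof.
apply: (iffP idP) => [/set_mem ub|[M uM]].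
  have [M [_ uM]] := ub; exists (M + 1) => n.
  by apply: uM => //; rewrite ltrDl.
apply/mem_set; exists M; split; first exact: num_real.
by move=> N MN n _ /=; exact: (le_trans (uM n) (ltW MN)).
Qed.

Lemma bounded_seq_submod_closed : submod_closed bounded_seq.
Proof.
split; first by apply/bounded_seqP; exists 0 => n; rewrite normr0.
move=> a u v /bounded_seqP[M uM] /bounded_seqP[N vN]; apply/bounded_seqP.
exists (`|a| * M + N) => n; rewrite (le_trans (ler_normD _ _))// lerD//.
by rewrite normrM ler_wpM2l.
Qed.

HB.instance Definition _ := GRing.isSubmodClosed.Build R (nat -> R^o)
  bounded_seq (GRing.submod_closed_semi bounded_seq_submod_closed).

Record linfty : Type :=
  Linfty { linfty_fun :> nat -> R^o ; linftyP : linfty_fun \in bounded_seq }.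

HB.instance Definition _ := [isSub for linfty_fun].
HB.instance Definition _ := [Choice of linfty by <:].
HB.instance Definition _ := [SubChoice_isSubZmodule of linfty by <:].
HB.instance Definition _ := [SubZmodule_isSubLmodule of linfty by <:].

Definition linfty_norm (x : linfty) : R := sup (range (fun n => `|x n|)).

Lemma has_sup_linfty (x : linfty) : has_sup (range (fun n => `|x n|)).
Proof.
split; first by exists `|x 0%N|, 0%N.
by have /bounded_seqP[M xM] := linftyP x; exists M => _ [n _ <-].
Qed.

Lemma linfty_norm_ge (x : linfty) n : `|x n| <= linfty_norm x.
Proof. by apply: (sup_upper_bound (has_sup_linfty x)); exists n. Qed.

Lemma linfty_norm_le (x : linfty) (M : R) :
  (forall n, `|x n| <= M) -> linfty_norm x <= M.
Proof.
move=> xM; apply: ge_sup; first exact: (has_sup_linfty x).1.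
by move=> _ [n _ <-].
Qed.

Lemma linfty_normD (x y : linfty) :
  linfty_norm (x + y) <= linfty_norm x + linfty_norm y.
Proof.
apply: linfty_norm_le => n; apply: (le_trans (ler_normD _ _)).
by apply: lerD; exact: linfty_norm_ge.
Qed.

Lemma linfty_normZ (a : R) (x : linfty) :
  linfty_norm (a *: x) = `|a| * linfty_norm x.
Proof.
have le b y : linfty_norm (b *: y) <= `|b| * linfty_norm y.
  apply: linfty_norm_le => n.
  by rewrite [`|_|]normrM ler_wpM2l// linfty_norm_ge.
apply/eqP; rewrite eq_le le/=; have [->|a0] := eqVneq a 0.
  by rewrite normr0 mul0r (le_trans _ (linfty_norm_ge _ 0%N)).
have /= := le a^-1 (a *: x); rewrite scalerA mulVf// scale1r normfV.
by rewrite -ler_pdivrMl// ?invr_gt0 ?normr_gt0// invrK.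
Qed.

Lemma linfty_norm0_eq0 (x : linfty) : linfty_norm x = 0 -> x = 0.
Proof.
move=> x0; apply/val_inj/funext => n /=; apply/eqP.
by rewrite -normr_le0 -x0 linfty_norm_ge.
Qed.

HB.instance Definition _ := Lmodule_isNormed.Build R linfty
  linfty_normD linfty_normZ linfty_norm0_eq0.

Lemma linfty_normE (x : linfty) : `|x| = sup (range (fun n => `|x n|)).
Proof. by []. Qed.

End linfty.

(** * Ideals and their cluster points *)

Definition is_ideal (X : Type) (I : set (set X)) : Prop :=
  [/\ (forall A B, I A -> I B -> I (A `|` B)),
      (forall A B, B `<=` A -> I A -> I B),
      ~ I [set: X] &
      forall x, I [set x]].

(* The trace of [A] on [X], as a subset of the type [X], is the preimage of
   [A] under the inclusion. *)
Definition ideal_restr (T : Type) (I : set (set T)) (X : set T) :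
  set (set X) := [set (set_val : X -> T) @^-1` A | A in I].
Arguments ideal_restr {T} I X.

Definition ideal_cluster (R : realType) (I : set (set nat)) (x : nat -> R) :
  set R :=
  [set t | forall e : R, 0 < e -> ~ I [set n | `|x n - t| < e]].

(* Cardinals are represented by sets: here [K] stands for its cardinality. *)
Definition Lclass (R : realType) (I : set (set nat)) (U : Type) (K : set U) :
  set (linfty R) :=
  [set x | ideal_cluster I x #= K].
Arguments Lclass R I {U} K.

(** * Topological notions *)

Definition nowhere_dense (T : topologicalType) (A : set T) : Prop :=
  interior (closure A) = set0.

Definition meager (T : topologicalType) (A : set T) : Prop :=
  exists F : nat -> set T,
    (forall n, nowhere_dense (F n)) /\ A = \bigcup_n F n.

Definition Baire_property (T : topologicalType) (A : set T) : Prop :=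
  exists2 U : set T, open U & meager (A `+` U).

Definition charfun (X : Type) (A : set X) : X -> bool := fun x => `[< A x >].

Definition ideal_Baire (X : Type) (I : set (set X)) : Prop :=
  @Baire_property (prod_topology (fun _ : X => bool)) (@charfun X @` I).

Definition ideal_hereditary_Baire (T : Type) (I : set (set T)) : Prop :=
  forall X : set T, ~ I X -> ideal_Baire (ideal_restr I X).

(* The density of [T] is the cardinality of [K]. *)
Definition has_density (T : topologicalType) (U : Type) (K : set U) : Prop :=
  (exists2 D : set T, dense D & D #= K) /\
  (forall D : set T, dense D -> K #<= D).

(* [V] carries the subspace topology; the continuum is the cardinality of
   [R]. *)
Definition has_closed_subspace_of_density_continuum (R : realType)
    (S : set (linfty R)) : Prop :=
  exists V : set (linfty R),
    [/\ submod_closed (mem V), closed V, V `<=` S &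
        has_density (initial_topology (set_val : V -> linfty R)) [set: R]].

(* Main.v *)
Require Import Defs.
From mathcomp Require Import all_boot all_order all_algebra.
From mathcomp Require Import all_classical all_reals all_analysis.
From mathcomp Require Import zify ring lra.
Import Order.TTheory GRing.Theory Num.Theory.
Import numFieldNormedType.Exports.
Local Open Scope classical_set_scope.
Local Open Scope ring_scope.
Local Open Scope card_scope.

Set Implicit Arguments.
Unset Strict Implicit.
Unset Printing Implicit Defensive.

(** An ideal with the Baire property admits, for every countable [T], a map
    [phi : nat -> T] all of whose fibres are positive (not in the ideal): a
    block argument in the style of Talagrand yields finite blocks such that a
    union of infinitely many of them is never in the ideal.

    With [T = (nat * int) * Q], let the subspace consist of the sequences
    [x n = z p * w q], where [phi n = (p, q)] and [z] ranges over a closed space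
    [Z] of functions on [nat * int].  It is closed, and its density is the
    continuum as soon as [Z] contains the indicators of the almost disjoint
    sets [{(n, floor (n r))}], [r] real.  The cluster points of [x] contain all
    the values [z p * w q] and lie in their closure.

    For (ii), [Z] is everything and [w] maps the rationals to a dense subset of
    an interval.  For (i), [w q = 1 / (q + 1)] and [Z] is the
    Johnson-Lindenstrauss space, whose elements have only countably many limit
    points since modulo null functions it is [c_0] of the continuum. *)

(** * Nowhere dense sets and finite patterns in the Cantor space *)

Section Cylinders.
Variables (X : eqType) (rank : X -> nat).
Hypothesis rank_inj : injective rank.
Local Notation cantor := (prod_topology (fun _ : X => bool)).

Definition agree (P : set X) (f g : X -> bool) := forall x, P x -> g x = f x.

Definition below (m : nat) : set X := [set x | (rank x < m)%N].

Lemma cylinder_nbhs (f : cantor) m : nbhs f (agree (below m) f).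
Proof.

elim: m => [|m IH]; first by exact: filterE.
have [[x xm]|nx] := pselect (exists x, rank x = m).
  have : nbhs f (proj x @^-1` [set f x]).
    by apply: (@proj_continuous X (fun=> bool) x f); exact: discrete_set1.
  move=> H; apply: filterS2 IH H => g gf gx y.
  rewrite /below/= ltnS leq_eqVlt => /orP[/eqP|ym]; last exact: gf.
  by rewrite -xm => /rank_inj ->.
apply: filterS IH => g gf y; rewrite /below/= ltnS leq_eqVlt => /orP[/eqP ym|ym].
  by case: nx; exists y.
exact: gf.
Qed.

(** The cylinders at [f] generate a filter that converges to [f] in every coordinate, hence in the
    product topology. *)
Lemma nbhs_cylinder (f : cantor) (U : set cantor) :
  nbhs f U -> exists m, agree (below m) f `<=` U.
Proof.
pose G := filter_from [set: nat] (fun m => agree (below m) f).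
have FG : Filter G.
  apply: filter_from_filter; first by exists 0%N.
  move=> i j _ _; exists (maxn i j) => // g gf; split=> x xi; apply: gf;
  by rewrite /below/= (leq_trans xi)// ?leq_maxl ?leq_maxr.
have : G --> f.
  apply/cvg_sup => x A [B [[C oC <-] Cf] BA].
  apply: (filterS BA); exists (rank x).+1 => // g gf.
  by rewrite /= gf// /below/=.
by move=> Gf /Gf[m _ mU]; exists m.
Qed.

Lemma nowhere_dense_cylinder (F : set cantor) (f : cantor) m :
  nowhere_dense F -> exists g n,
    agree (below m) f g /\ forall h, agree (below n) g h -> ~ F h.
Proof.
move=> ndF.
have [g [fg nFg]] : exists g, agree (below m) f g /\ ~ closure F g.
  apply: contrapT => H.
  have : interior (closure F) f.
    apply: filterS (cylinder_nbhs f m) => g fg.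
    by apply: contrapT => nFg; apply: H; exists g.
  by rewrite ndF.
have [B [gB FB]] : exists B, nbhs (g : cantor) B /\ ~ (F `&` B !=set0).
  apply: contrapT => H; apply: nFg => B gB.
  by apply: contrapT => FB; apply: H; exists B.
have [n nB] := nbhs_cylinder gB; exists g, n; split=> // h gh Fh.
by apply: FB; exists h; split=> //; exact: nB.
Qed.

Definition ranked (m n : nat) : set X := [set x | (m <= rank x < n)%N].

(* Induction on [t], the number of low coordinates at which [g] is unconstrained:
   at each step the two values at rank [t] are treated one after the other. *)
Lemma nowhere_dense_tail_heads (F : set cantor) m t h p n :
  nowhere_dense F -> (t <= m)%N -> (m <= n)%N -> exists q l,
    [/\ (n <= l)%N, agree (ranked m n) p q &
      forall g, agree (ranked m l) q g -> agree (ranked t m) h g -> ~ F g].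
Proof.
move=> ndF; elim: t h p n => [|t IH] h p n tm mn.
  (* All low coordinates are prescribed here, so one use of nowhere density at [f] is enough. *)
  pose f x := if (rank x < m)%N then h x else p x.
  have [q [l [fq qF]]] := nowhere_dense_cylinder f n ndF.
  exists q, (maxn n l); split; first exact: leq_maxl.
    by move=> x /andP[mx xn]; rewrite fq// /f ltnNge mx.
  move=> g qg hg; apply: (qF) => x; rewrite /below/= => xl.
  have [xm|mx] := ltnP (rank x) m; last first.
    by apply: qg; rewrite /ranked/= mx leq_max xl orbT.
  rewrite hg ?/ranked//= fq ?/f ?xm//.
  by rewrite /below/= (leq_trans xm).
have [q [l [nl pq qF]]] := IH h p n (ltnW tm) mn.
pose h' x := if rank x == t then ~~ h x else h x.
have [r [k [lk qr rF]]] := IH h' q l (ltnW tm) (leq_trans mn nl).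
exists r, k; split; first exact: leq_trans lk.
  move=> x /andP[mx xn]; rewrite qr ?/ranked/= ?mx ?(leq_trans xn)//.
  by apply: pq; rewrite /ranked/= mx.
move=> g rg hg.
have [[x xt gx]|nx] := pselect (exists2 x, rank x = t & g x <> h x).
  apply: rF => // y /andP[ty ym]; rewrite /h'.
  case: eqVneq => [yt|yt]; last first.
    by apply: hg; rewrite /ranked/= ltn_neqAle eq_sym yt ty.
  have -> : y = x by apply: rank_inj; rewrite yt.
  by move: gx; case: (g x) (h x) => [] [].
apply: qF => [x /andP[mx xl]|y /andP[ty ym]].
  rewrite rg ?qr// /ranked/= mx//= (leq_trans xl)//.
have [yt|yt] := eqVneq (rank y) t; last first.
  by apply: hg; rewrite /ranked/= ltn_neqAle eq_sym yt ty.
by apply: contrapT => gy; apply: nx; exists y.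
Qed.

(** With every coordinate below rank [m] left free, the [k] sets are avoided one after the other,
    each time by extending the pattern. *)
Lemma nowhere_dense_tail (F : nat -> set cantor) m k :
  (forall i, nowhere_dense (F i)) -> exists q l,
    (m < l)%N /\
      forall g, agree (ranked m l) q g -> forall i, (i < k)%N -> ~ F i g.
Proof.
move=> ndF; elim: k => [|k [p [n [mn pF]]]].
  by exists (fun=> true), m.+1.
have [q [l [nl pq qF]]] :=
  nowhere_dense_tail_heads p p (ndF k) (leqnn m) (ltnW mn).
exists q, l; split; first exact: leq_trans nl.
move=> g qg i; rewrite ltnS leq_eqVlt => /orP[/eqP->|ik].
  by apply: qF => // x /andP[mx xm]; rewrite ltnNge mx in xm.
apply: pF ik => x /andP[mx xn]; rewrite qg ?pq// /ranked/= mx//=.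
exact: leq_trans nl.
Qed.

(** Block [k] consists of the ranks from [c k] up to [c k.+1], excluded; its pattern avoids each
    [F i] with [i < k], whatever happens on the other blocks. Matching arbitrarily late blocks
    therefore avoids every [F i]. *)
Lemma meager_block_pattern (F : nat -> set cantor) :
  (forall i, nowhere_dense (F i)) -> exists (b : X -> nat) (s : X -> bool),
    (forall m, exists k, forall x, (rank x < m)%N -> (b x < k)%N) /\
    forall g : X -> bool,
      (forall N, exists2 k, (N <= k)%N & agree [set x | b x = k] s g) ->
      forall i, ~ F i g.
Proof.
move=> ndF.
have [Q HQ] := choice (fun km => nowhere_dense_tail km.2 km.1 ndF).
have [L HL] := choice HQ.
pose c := fix c k := if k is k'.+1 then L (k', c k') else 0%N.
have cS k : (c k < c k.+1)%N by have [] := HL (k, c k).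
have cmono : {homo c : i j / (i <= j)%N}.
  by apply: homo_leq => // [? ? ?|i]; [exact: leq_trans|exact: ltnW].
have cge k : (k <= c k)%N by elim: k => // k IH; exact: leq_ltn_trans (cS k).
have /choice[b Hb] : forall x, exists k, ranked (c k) (c k.+1) x.
  move=> x; have H : exists k, (rank x < c k)%N.
    by exists (rank x).+1; rewrite (leq_trans _ (cge _)).
  case: (ex_minnP H) => -[|k] // xk kmin; exists k; rewrite /ranked/= xk andbT.
  by rewrite leqNgt; apply/negP => /kmin; rewrite ltnn.
have bE k x : ranked (c k) (c k.+1) x -> b x = k.
  move=> /andP[kx xk]; have /andP[bx xb] := Hb x.
  apply/eqP; rewrite eqn_leq; apply/andP; split; rewrite leqNgt; apply/negP.
    by move=> /cmono /(leq_trans xk)/leq_trans /(_ bx); rewrite ltnn.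
  by move=> /cmono /(leq_trans xb)/leq_trans /(_ kx); rewrite ltnn.
exists b, (fun x => Q (b x, c (b x)) x); split.
  move=> m; exists m => x xm; rewrite ltnNge; apply/negP => mb.
  have /andP[bx _] := Hb x.
  by have := leq_trans (leq_trans mb (cge _)) bx; rewrite leqNgt xm.
move=> g gs i; have [k ik sg] := gs i.+1.
have [_] := HL (k, c k); apply; last exact: ik.
by move=> x /bE xk; rewrite sg//= xk.
Qed.

End Cylinders.

(** * Ideals with the Baire property *)

(** [J] equals the open set [U] modulo the meager union of the [F n]. If [U] is empty, no member of
    [J] follows the pattern [s] on infinitely many blocks. If not, members of [U] that follow it on
    infinitely many blocks lie in [J], and this forces the whole of [X] into [J]. *)
Lemma Baire_ideal_blocks (X : choiceType) (rank : X -> nat) (J : set (set X)) :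
  injective rank -> is_ideal J -> ideal_Baire J ->
  exists f : X -> nat, forall k, ~ J (f @^-1` [set k]).
Proof.
move=> rank_inj [JU Jsub JT J1] [U oU [F [ndF UF]]].
have [b [s [bfin bF]]] := meager_block_pattern rank_inj ndF.
have inJ A : (charfun (X:=X) @` J) (charfun A) <-> J A.
  split=> [[B JB BA]|]; last by exists A.
  suff -> : A = B by [].
  by apply/seteqP; split=> x Ax; move: (congr1 (@^~ x) BA);
    rewrite /charfun; [rewrite (asboolT Ax)|rewrite (asboolT Ax) => /esym] => /asboolW.
have [[f Uf]|U0] := pselect (U !=set0); last first.
  (* [J] is meager: distribute the blocks so that each fibre gets infinitely
     many of them. *)
  have [e He] : exists e : nat -> nat, forall k N, exists2 n, (N <= n)%N & e n = k.
    (* The first component of the decoded pair takes each value [k] at all the codes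
       [pickle (k, n)]. *)
    pose e n := (odflt (0, 0)%N (unpickle n : option (nat * nat))).1.
    exists e => k N.
    have [n Nn] : exists n : nat, (N <= pickle (k, n))%N.
      have inj : injective (fun n : nat => pickle (k, n)).
        by move=> i j /(pcan_inj pickleK)[].
      by have [n /ltnW] := injective_gtn inj N; exists n.
    by exists (pickle (k, n)) => //; rewrite /e pickleK.
  exists (e \o b) => k Jk.
  (* A subset of the fibre that follows the pattern on every block assigned to [k]. *)
  pose A := [set x | e (b x) = k /\ s x].
  have JA : J A by apply: Jsub Jk => x [].
  have : (\bigcup_n F n) (charfun A).
    rewrite -UF; left; split; first exact/inJ.
    by move=> UA; apply: U0; exists (charfun A).
  move=> [i _]; apply: (bF _ _ i) => N; have [n Nn enk] := He k N.
  exists n => // x /= bx; rewrite /charfun /A/= bx enk.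
  by apply/asboolP/idP => [[]|].
have [m mU] : exists m, agree (below rank m) f `<=` U.
  by apply: nbhs_cylinder; rewrite nbhsE; exists U.
exfalso.
(* [g1] follows the pattern on the odd blocks and [g2] on the even ones, so both
   are in [J], but they are complementary above rank [m]. *)
pose g1 x := if (rank x < m)%N then f x else if odd (b x) then s x else ~~ s x.
pose g2 x := if (rank x < m)%N then f x else ~~ g1 x.
have [K bK] := bfin m.
have key g (o : bool) : agree (below rank m) f g ->
    (forall x, (m <= rank x)%N -> odd (b x) = o -> g x = s x) -> J [set x | g x].
  move=> fg gs; apply/inJ.
  have -> : charfun [set x | g x] = g.
    by apply/funext => x; rewrite /charfun/=; exact/asboolP/idP.
  apply: contrapT => nJ.
  have [i _] : (\bigcup_n F n) g by rewrite -UF; right; split=> //; exact: mU.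
  (* The index has parity [o], is at least [N], and is at least [K], so that its block lies at ranks
     [m] and above. *)
  apply: (bF _ _ i) => N; exists ((N + K).*2 + o)%N.
    by rewrite -addnn; lia.
  move=> x /= bx; apply: gs; last by rewrite bx oddD odd_double/= oddb.
  rewrite leqNgt; apply/negP => /bK; rewrite bx -addnn; lia.
have J1' : J [set x | g1 x].
  apply: (key _ true) => x; rewrite /below/= /g1; first by move=> ->.
  by rewrite leqNgt => /negbTE -> ->.
have J2' : J [set x | g2 x].
  apply: (key _ false) => x; rewrite /below/= /g2 /g1; [by move=> ->|].
  by rewrite leqNgt => /negbTE -> ->; rewrite negbK.
(* Below rank [m], [g1] and [g2] both copy [f] and need not cover; that region is finite. *)
have Jm k : J (below rank k).
  elim: k => [|k IH].
    by apply: Jsub J1' => x.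
  have [[x xk]|nx] := pselect (exists x, rank x = k).
    apply: Jsub (JU _ _ IH (J1 x)) => y; rewrite /below/= ltnS leq_eqVlt.
    by move=> /orP[/eqP|]; [rewrite -xk => /rank_inj; right|left].
  apply: Jsub IH => y; rewrite /below/= ltnS leq_eqVlt => /orP[/eqP yk|//].
  by case: nx; exists y.
apply: JT; apply: Jsub (JU _ _ (Jm m) (JU _ _ J1' J2')) => x _.
rewrite /below/= /g2; case: ltnP => [|_]; first by left.
by right; case: (g1 x); [left|right].
Qed.

(** * The cardinality of the space of bounded sequences *)

Section Cardinality.
Variable R : realType.

Lemma inj_card_leT (T U : Type) (f : T -> U) (D : set U) :
  injective f -> (forall x, D (f x)) -> [set: T] #<= D.
Proof.
move=> finj Df; apply: (@card_le_trans _ _ _ (range f)).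
  have : range f #= [set: T] by apply: inj_card_eq => x y _ _ /finj.
  by rewrite card_eq_sym card_eq_le => /andP[].
by apply: subset_card_le => _ [x _ <-].
Qed.

(** Digits 0 and 1 in base 3 rather than 2 make expansions unique. *)
Definition ternary_sum (f : nat -> bool) (n : nat) : R :=
  \sum_(i < n) (f i)%:R * 3^-1 ^+ i.

Lemma ternary_sumS f n :
  ternary_sum f n.+1 = ternary_sum f n + (f n)%:R * 3^-1 ^+ n.
Proof. by rewrite /ternary_sum big_ord_recr. Qed.

(** [3 / 2 * 3^-1 ^+ n] is the geometric tail from index [n] on: the sums are nondecreasing, the
    sums plus tail nonincreasing. *)
Lemma ternary_sum_le f m n :
  ternary_sum f m <= ternary_sum f n + 3 / 2 * 3^-1 ^+ n.
Proof.
have p k : 0 < (3^-1 : R) ^+ k by rewrite exprn_gt0// invr_gt0.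
have nd : {homo ternary_sum f : i j / (i <= j)%N >-> i <= j}.
  apply: homo_leq => [//|? ? ?|k]; first exact: le_trans.
  by rewrite ternary_sumS lerDl mulr_ge0// ltW.
have ni : {homo (fun k => - (ternary_sum f k + 3 / 2 * 3^-1 ^+ k)) :
    i j / (i <= j)%N >-> i <= j}.
  apply: homo_leq => [//|? ? ?|k]; first exact: le_trans.
  rewrite lerN2 ternary_sumS exprS; have := p k.
  by case: (f k) => /= ?; lra.
have [/nd mn|/ltnW /ni] := leqP m n; first by have := p n; lra.
by have := p m; lra.
Qed.

Lemma has_sup_ternary_sum f : has_sup (range (ternary_sum f)).
Proof.
split; first by exists (ternary_sum f 0), 0%N.
exists (ternary_sum f 0 + 3 / 2 * 3^-1 ^+ 0) => _ [n _ <-].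
exact: ternary_sum_le.
Qed.

(** At the first index [n] where the digits differ, the term [3^-1 ^+ n] is twice the bound on the
    remaining tail. *)
Lemma ternary_sum_inj : injective (fun f => sup (range (ternary_sum f))).
Proof.
move=> f g fg; apply/funext => n; elim/ltn_ind: n => n IH.
wlog [fn gn] : f g fg IH / f n /\ ~~ g n => [W|].
  case fn: (f n); case gn: (g n) => //; rewrite -gn -fn.
    by apply: W; rewrite ?fn ?gn.
  by apply/esym/W; rewrite ?fn ?gn// => i /IH.
have S : ternary_sum f n = ternary_sum g n.
  by apply: eq_bigr => i _; rewrite IH.
have p : 0 < (3^-1 : R) ^+ n by rewrite exprn_gt0// invr_gt0.
have : ternary_sum f n.+1 <= sup (range (ternary_sum f)).
  by apply: (sup_upper_bound (has_sup_ternary_sum f)); exists n.+1.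
have : sup (range (ternary_sum g)) <= ternary_sum g n.+1 + 3 / 2 * 3^-1 ^+ n.+1.
  apply: ge_sup; first exact: (has_sup_ternary_sum g).1.
  by move=> _ [m _ <-]; exact: ternary_sum_le.
rewrite fg !ternary_sumS S fn (negbTE gn) exprS /=; lra.
Qed.

Lemma card_linfty_le : [set: linfty R] #<= [set: R].
Proof.
(* The Dedekind cuts of all entries of [x], coded as one binary sequence. *)
pose h (x : linfty R) (k : nat) :=
  if unpickle k is Some (n, q) then (ratr q : R) < x n else false.
apply: (@inj_card_leT _ _ (fun x => sup (range (ternary_sum (h x))))) => //.
move=> x y /ternary_sum_inj xy.
have hq n (q : rat) : ((ratr q : R) < x n) = (ratr q < y n).
  by have := congr1 (@^~ (pickle (n, q))) xy; rewrite /h pickleK.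
apply/val_inj/funext => n /=; apply/eqP; rewrite eq_le; apply/andP.
have rat_lt (a b : R) : (forall q, (ratr q < a) = (ratr q < b)) -> a <= b.
  move=> ab; rewrite leNgt; apply/negP => /rat_in_itvoo[q].
  by rewrite in_itv/= ab => /andP[/ltW]; rewrite leNgt => /negbTE ->.
by split; apply: rat_lt => q.
Qed.

End Cardinality.

(* An almost disjoint family indexed by the reals. *)
Definition line (R : realType) (r : R) : set (nat * int) :=
  [set p | p.2 = Num.floor (p.1%:R * r)].

(** Equal floors force [n * |r - s| < 1], which fails once [n] exceeds [1 / |r - s|]. *)
Lemma line_separated (R : realType) (r s : R) : r != s ->
  exists N, forall n, (N <= n)%N -> ~ line s (n, Num.floor (n%:R * r)).
Proof.
rewrite -subr_eq0 -normr_gt0 => rs.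
exists (Num.truncn `|r - s|^-1).+1 => n Nn; rewrite /line/= => fl.
have n1 : 1 < n%:R * `|r - s|.
  rewrite -ltr_pdivrMr// div1r (lt_le_trans (truncnS_gt _))//.
  by rewrite ler_nat.
have := floor_itv (n%:R * r); have := floor_itv (n%:R * s); rewrite -fl.
rewrite intrD; set m := (Num.floor _)%:~R => /andP[a b] /andP[c d].
have : `|n%:R * (r - s)| < 1 by rewrite ltr_norml mulrBr; apply/andP; split; lra.
by rewrite normrM (ger0_norm (ler0n _ _)) ltNge (ltW n1).
Qed.

Lemma closed_linfty (R : realType) (V : set (linfty R)) :
  (forall x : linfty R,
    (forall e : R, 0 < e -> exists2 y, V y & forall n, `|x n - y n| <= e) -> V x) ->
  closed V.
Proof.
move=> HV x Vx; apply: HV => e e0.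
have [y [Vy]] := Vx _ (nbhsx_ballx x e e0).
rewrite -ball_normE/= => xy; exists y => // n.
by apply: le_trans (ltW xy); have := linfty_norm_ge (x - y) n.
Qed.

(** * The closed subspace of weighted sequences and its density *)

Section Subspace.
Variables (R : realType) (Q : countType) (w : Q -> R) (q0 : Q) (C : R).
Variables (phi : nat -> (nat * int) * Q) (psi : nat * int -> nat).
Variable Z : set (nat * int -> R).
Hypothesis wC : forall q, `|w q| <= C.
Hypothesis w1 : w q0 = 1.
Hypothesis psiK : forall p, phi (psi p) = (p, q0).
Hypothesis Z0 : Z (fun=> 0).
Hypothesis ZD : forall a f g, Z f -> Z g -> Z (fun p => a * f p + g p).
Hypothesis Zclosed : forall f,
  (forall e : R, 0 < e -> exists2 g, Z g & forall p, `|f p - g p| <= e) -> Z f.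
Hypothesis Zline : forall r : R, Z (\1_(line r)).

(* The function [z] of the header is [x \o psi]; writing it so makes membership
   stable under uniform limits. *)
Definition weighted_space : set (linfty R) :=
  [set x | (forall n, x n = x (psi (phi n).1) * w (phi n).2) /\
           Z (x \o psi)].

Lemma weighted_space_submod : submod_closed (mem weighted_space).
Proof.
split=> [|a x y /set_mem[xw Zx] /set_mem[yw Zy]]; apply/mem_set; split.
- by move=> n; rewrite mul0r.
- exact: Z0.
- move=> n; rewrite -[LHS]/(a * x n + y n) xw yw.
  by rewrite mulrA -mulrDl.
- exact: (ZD a Zx Zy).
Qed.

Lemma weighted_space_closed : closed weighted_space.
Proof.
apply: closed_linfty => x xV; split=> [n|]; last first.
  by apply: Zclosed => e /xV[y [_ Zy] xy]; exists (y \o psi) => // p; exact: xy.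
have C0 : 0 <= C by exact: le_trans (normr_ge0 _) (wC (phi 0%N).2).
apply/eqP; rewrite -subr_eq0 -normr_le0; apply/ler_addgt0Pl => e e0.
(* Since [y] satisfies the product formula, the defect of [x] at [n] is that of [x - y], at most
   [1 + C] times the distance. *)
have [|y [yw _] xy] := xV (e / (1 + C)); first by rewrite divr_gt0// ltr_wpDr.
rewrite addr0 (_ : x n - _ =
  (x n - y n) - (x (psi (phi n).1) - y (psi (phi n).1)) * w (phi n).2); last first.
  by rewrite [y n]yw; ring.
rewrite (le_trans (ler_normB _ _))// normrM.
rewrite -[leRHS](@divfK _ (1 + C)) ?gt_eqF ?ltr_wpDr// mulrDr mulr1 lerD//.
by rewrite ler_pM.
Qed.

Definition weighted_line (r : R) (n : nat) : R^o :=
  \1_(line r) (phi n).1 * w (phi n).2.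

Lemma weighted_line_bounded r : weighted_line r \in @bounded_seq R.
Proof.
apply/bounded_seqP; exists C => n; rewrite /weighted_line normrM.
rewrite -[leRHS]mul1r ler_pM// indicE.
by case: (_ \in _); rewrite ?normr1 ?normr0.
Qed.

Definition line_vector r : linfty R := Linfty (weighted_line_bounded r).

Lemma line_vector_psi r p : line_vector r (psi p) = \1_(line r) p.
Proof. by rewrite /= /weighted_line psiK/= w1 mulr1. Qed.

Lemma line_vector_in r : weighted_space (line_vector r).
Proof.
split=> [n|]; first by rewrite line_vector_psi.
rewrite (_ : _ \o _ = \1_(line r) :> (_ -> R)); first exact: Zline.
by apply/funext => p; rewrite [LHS]line_vector_psi.
Qed.

(** Vectors of distinct lines are at distance at least 1, as seen at a point of one line that is off
    the other. *)
Lemma line_vector_separated r s (x : linfty R) :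
  `|line_vector r - x| < 2^-1 -> `|line_vector s - x| < 2^-1 -> r = s.
Proof.
move=> rx sx; apply/eqP; apply: contrapT => /negP rs.
have [N /(_ N (leqnn _)) Nrs] := line_separated rs.
set p := (N, _) in Nrs.
have : `|line_vector r - line_vector s| < 1.
  rewrite (_ : _ - _ = (line_vector r - x) - (line_vector s - x)); last first.
    by rewrite opprB addrA subrK.
  by rewrite (le_lt_trans (ler_normB _ _))// (splitr 1) !div1r ltrD.
rewrite ltNge => /negP; apply.
apply: le_trans (linfty_norm_ge _ (psi p)).
rewrite -[X in `|X|]/(line_vector r (psi p) - line_vector s (psi p)).
rewrite !line_vector_psi !indicE.
by rewrite mem_set// memNset//= subr0 normr1.
Qed.

(** The whole space is dense and has at most continuum many points. Conversely, a dense set meets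
    the ball of radius 1/2 around each line vector, at distinct points for distinct lines. *)
Lemma weighted_space_density :
  has_density (initial_topology (set_val : weighted_space -> linfty R)) [set: R].
Proof.
pose W := initial_topology (set_val : weighted_space -> linfty R).
pose e r : W := SigSub (mem_set (line_vector_in r)).
split.
  exists setT; first by move=> O [x Ox] _; exists x.
  rewrite card_eq_le; apply/andP; split; last first.
    apply: (@inj_card_leT _ _ e) => // r s rs.
    apply: (@line_vector_separated _ _ (line_vector r));
      rewrite ?[line_vector s](congr1 val (esym rs)) subrr normr0 invr_gt0//.
  apply: card_le_trans (card_linfty_le R).
  by apply: (@inj_card_leT _ _ val) => // x y /val_inj.
move=> D dD.
have /choice[d dP] : forall r, exists d : W, D d /\ `|line_vector r - val d| < 2^-1.
  move=> r; have [||x [xr Dx]] := dD (val @^-1` ball (line_vector r) 2^-1).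
  - by exists (e r); apply: ballxx; rewrite invr_gt0.
  - exists (ball (line_vector r) 2^-1) => //; exact: ball_open.
  - by exists x; split=> //; move: xr; rewrite -ball_normE.
apply: (@inj_card_leT _ _ d) => [r s rs|r]; last exact: (dP r).1.
by apply: (line_vector_separated (dP r).2); rewrite rs; exact: (dP s).2.
Qed.

End Subspace.

(** * Families of values bounded away from a point *)

Section Away.
Variables (R : realType) (T : Type) (u : T -> R) (t : R).

(** Says that [t] is outside the closure of the image of [S]. *)
Definition away (S : set T) : Prop :=
  exists2 e : R, 0 < e & forall x, S x -> e <= `|u x - t|.

Lemma away_sub S S' : S `<=` S' -> away S' -> away S.
Proof. by move=> SS' [e e0 He]; exists e => // x /SS'; exact: He. Qed.

Lemma awayU S S' : away S -> away S' -> away (S `|` S').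
Proof.
move=> [e e0 He] [d d0 Hd]; exists (Num.min e d); first by rewrite lt_min e0.
by move=> x [/He|/Hd] h; rewrite ge_min h ?orbT.
Qed.

Lemma away_bigcup (K : eqType) (D : set K) (S : K -> set T) :
  finite_set D -> (forall i, D i -> away (S i)) -> away (\bigcup_(i in D) S i).
Proof.
move=> /finite_seqP[s ->]; elim: s => [|i s IH] H.
  by exists 1 => // x [].
apply: (@away_sub _ (S i `|` \bigcup_(i in [set` s]) S i)).
  move=> x [j /=]; rewrite inE => /orP[/eqP->|js] Sx; first by left.
  by right; exists j.
apply: awayU; first by apply: H; rewrite /= mem_head.
by apply: IH => j js; apply: H; rewrite /= inE js orbT.
Qed.

Lemma away1 x : u x != t -> away [set x].
Proof. by move=> xt; exists `|u x - t| => [|_ ->//]; rewrite normr_gt0 subr_eq0. Qed.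

End Away.

Lemma away_finite (R : realType) (T : eqType) (u : T -> R) (t : R) (S : set T) :
  finite_set S -> (forall x, u x != t) -> away u t S.
Proof.
move=> fS ut; apply: away_sub (away_bigcup (S := set1) fS _) => [x Sx|x _].
  by exists x.
exact: away1.
Qed.

(** A tail stays within half of [|l - t|] of [l]; the finitely many other terms all differ from
    [t]. *)
Lemma away_cvg (R : realType) (u : nat -> R) (l t : R) (S : set nat) :
  u @ \oo --> l -> l != t -> (forall n, u n != t) -> away u t S.
Proof.
move=> ul lt ut.
have d0 : 0 < `|l - t| / 2 by rewrite divr_gt0// normr_gt0 subr_eq0.
have /cvgrPdist_lt/(_ _ d0)[N _ HN] := ul.
apply: (@away_sub _ _ _ _ _ (`I_N `|` [set n | (N <= n)%N])).
  by move=> n _; case: (ltnP n N) => nN; [left|right].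
apply: awayU; first by apply: away_finite => //; exact: finite_II.
exists (`|l - t| / 2) => // n /HN /= ln.
have := ler_distD (u n) l t; move: ln; set a := `|l - u n|; set b := `|l - t|.
by move=> *; lra.
Qed.

(** * The Johnson-Lindenstrauss space *)

Section JohnsonLindenstrauss.
Variable R : realType.

Definition along (z : nat * int -> R) (r : R) (n : nat) : R :=
  z (n, Num.floor (n%:R * r)).

(* Convergence along the lines is stated as a Cauchy condition, which passes to
   uniform limits without choosing limits. *)
Definition JL : set (nat * int -> R) :=
  [set z |
    (forall r e : R, 0 < e -> exists N, forall n, (N <= n)%N ->
       `|along z r n - along z r N| <= e) /\
    (forall e : R, 0 < e -> exists2 D : set R, finite_set D &
       finite_set ([set p | e < `|z p|] `\` \bigcup_(r in D) line r))].

Lemma JL0 : JL (fun=> 0).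
Proof.
split=> [r e e0|e e0]; first by exists 0%N => n _; rewrite subrr normr0 ltW.
exists set0 => //; apply: sub_finite_set (finite_set0 _) => p [/=].
by rewrite normr0 ltNge (ltW e0).
Qed.

Lemma JL_cauchy_le (z : nat * int -> R) (r e : R) :
  (exists N, forall n, (N <= n)%N -> `|along z r n - along z r N| <= e) ->
  exists N, forall m n, (N <= m)%N -> (N <= n)%N ->
    `|along z r n - along z r m| <= e + e.
Proof.
move=> [N HN]; exists N => m n /HN mN /HN nN.
by rewrite (le_trans (ler_distD (along z r N) _ _))// lerD// distrC.
Qed.

Lemma JLD a f g : JL f -> JL g -> JL (fun p => a * f p + g p).
Proof.
move=> [fc fF] [gc gF]; pose b := 1 + `|a|.
have b0 : 0 < b by rewrite ltr_pwDl.
split=> [r e e0|e e0].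
  (* [JL_cauchy_le] doubles this bound and the combination multiplies it by at most [b], giving
     [e / 2]. *)
  have e4 : 0 < e / 4 / b by rewrite !divr_gt0.
  have [N1 H1] := JL_cauchy_le (fc r _ e4).
  have [N2 H2] := JL_cauchy_le (gc r _ e4).
  exists (maxn N1 N2) => n; rewrite geq_max => /andP[n1 n2].
  have {}H1 := H1 _ _ (leq_maxl N1 N2) n1.
  have {}H2 := H2 _ _ (leq_maxr N1 N2) n2.
  rewrite /along in H1 H2 *; set N := maxn _ _ in H1 H2 *.
  rewrite [X in `|X|](_ : _ =
    a * (f (n, Num.floor (n%:R * r)) - f (N, Num.floor (N%:R * r))) +
    (g (n, Num.floor (n%:R * r)) - g (N, Num.floor (N%:R * r)))); last by ring.
  rewrite (le_trans (ler_normD _ _))// normrM.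
  apply: (@le_trans _ _ (`|a| * (e / 4 / b + e / 4 / b) + (e / 4 / b + e / 4 / b))).
    by rewrite lerD// ler_wpM2l.
  have : e / 4 / b * b = e / 4 by rewrite divfK// gt_eqF.
  by rewrite {2}/b; set c := e / 4 / b => cb; nra.
have e2 : 0 < e / b by rewrite divr_gt0.
have [D1 D1f H1] := fF _ e2; have [D2 D2f H2] := gF _ e2.
exists (D1 `|` D2); first by rewrite finite_setU.
apply: sub_finite_set (_ : finite_set (_ `|` _)); last first.
  by rewrite finite_setU; split; [exact: H1|exact: H2].
move=> p [/= ep nD].
have [fp|fp] := ltP (e / b) `|f p|.
  by left; split=> // -[r Dr rp]; apply: nD; exists r => //; left.
right; split=> [|[r Dr rp]]; last by apply: nD; exists r => //; right.
rewrite /= ltNge; apply/negP => gp.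
move: ep; rewrite ltNge => /negP; apply.
rewrite (le_trans (ler_normD _ _))// normrM.
rewrite -[leRHS](@divfK _ b) ?gt_eqF// mulrDr mulr1 addrC lerD//.
by rewrite mulrC ler_wpM2r.
Qed.

Lemma JL_closed f :
  (forall e : R, 0 < e -> exists2 g, JL g & forall p, `|f p - g p| <= e) -> JL f.
Proof.
move=> fg; split=> [r e e0|e e0].
  have e3 : 0 < e / 3 by rewrite divr_gt0.
  have [g [gc _] fgp] := fg _ e3; have [N HN] := gc r _ e3.
  exists N => n /HN; rewrite /along.
  have := fgp (n, Num.floor (n%:R * r)).
  have := fgp (N, Num.floor (N%:R * r)).
  by rewrite !ler_norml => /andP[? ?] /andP[? ?] /andP[? ?]; apply/andP; split; lra.
have e2 : 0 < e / 2 by rewrite divr_gt0.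
have [g [_ gF] fgp] := fg _ e2; have [D Df H] := gF _ e2.
exists D => //; apply: sub_finite_set H => p [/= ep nD]; split=> //=.
have := fgp p; have := ler_distD (g p) (f p) 0; rewrite !subr0.
by move=> *; lra.
Qed.

(** The indicator is constantly 1 along its own line and eventually 0 along any other. *)
Lemma JL_line (r : R) : JL (\1_(line r) : _ -> R).
Proof.
split=> [s e e0|e e0]; last first.
  exists [set r] => //; apply: sub_finite_set (finite_set0 _) => p [/= ep nr].
  have rp : ~ line r p by move=> rp; apply: nr; exists r.
  by move: ep; rewrite indicE memNset// normr0 ltNge (ltW e0).
have [<-|sr] := eqVneq s r.
  exists 0%N => n _; rewrite /along !indicE !mem_set// subrr normr0 ltW//.
have [N HN] := line_separated sr.
exists N => n Nn; rewrite /along !indicE !memNset ?subrr ?normr0 ?ltW//; exact: HN.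
Qed.

Lemma JL_along_cvg z r : JL z -> cvgn (along z r).
Proof.
move=> [zc _]; apply/cauchy_cvgP/cauchy_exP => e e0.
have e2 : 0 < e / 2 by rewrite divr_gt0.
have [N HN] := zc r _ e2; exists (along z r N), N => // n /HN /= h.
by rewrite -ball_normE /= distrC (le_lt_trans h)//; lra.
Qed.

End JohnsonLindenstrauss.

(** * Cluster points of the weighted sequences *)

Section Clusters.
Variables (R : realType) (I : set (set nat)) (hI : is_ideal I).

Lemma ideal_set0 : I set0.
Proof. by have [_ Isub _ I1] := hI; apply: Isub (I1 0%N) => x. Qed.

Lemma cluster_fibre (T : Type) (x : nat -> R) (phi : nat -> T) (u : T -> R) t :
  (forall c, ~ I (phi @^-1` [set c])) -> (forall n, x n = u (phi n)) ->
  (forall e, 0 < e -> exists c, `|u c - t| < e) -> ideal_cluster I x t.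
Proof.
have [_ Isub _ _] := hI.
move=> phiI xu ut e e0; have [c cte] := ut e e0.
move=> Ix; apply: (phiI c); apply: Isub Ix => n /= nc.
by rewrite xu nc.
Qed.

Lemma cluster_away (T : Type) (x : nat -> R) (phi : nat -> T) (u : T -> R) t :
  (forall n, x n = u (phi n)) -> ideal_cluster I x t -> ~ away u t setT.
Proof.
have [_ Isub _ _] := hI.
move=> xu xt [e e0 He]; apply: (xt e e0); apply: Isub ideal_set0 => n /=.
by rewrite xu ltNge He.
Qed.

Variables (phi : nat -> (nat * int) * nat) (y : nat * int -> R).
Hypothesis phiI : forall c, ~ I (phi @^-1` [set c]).
Variable x : nat -> R.
Let u (c : (nat * int) * nat) : R := y c.1 * c.2.+1%:R^-1.
Hypothesis xu : forall n, x n = u (phi n).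

(** The values [y p / (j + 1)] are distinct cluster points. *)
Lemma JL_cluster_infinite p : y p != 0 -> [set: nat] #<= ideal_cluster I x.
Proof.
move=> yp; apply: (@inj_card_leT _ _ (fun j => u (p, j))) => [i j|j].
  by move=> /(mulfI yp)/invr_inj/eqP; rewrite eqr_nat => /eqP[].
apply: (cluster_fibre phiI xu) => e e0.
by exists (p, j); rewrite subrr normr0.
Qed.

(** Cluster points lie in the countable set [S]: zero, the values, and the limits along countably
    many lines divided by the [j + 1]. For [t] outside [S], the indices are covered by finitely many
    pieces on which the values stay away from [t]. *)
Lemma JL_cluster_countable (M : R) : JL y -> (forall p, `|y p| <= M) ->
  countable (ideal_cluster I x).
Proof.
move=> yJL yM; have [_ yF] := yJL.
have /choice[D HD] : forall m : nat, exists D : set R, finite_set D /\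
    finite_set ([set p | m.+1%:R^-1 < `|y p|] `\` \bigcup_(r in D) line r).
  by move=> m; have [|D Df H] := yF m.+1%:R^-1; [rewrite invr_gt0|exists D].
pose L := \bigcup_m D m.
pose S : set R := [set 0] `|` range u `|`
  \bigcup_(j in [set: nat]) [set lim (along y r @ \oo) * j.+1%:R^-1 | r in L].
have cS : countable S.
  have cim (K : Type) (A : set K) (f : K -> R) : countable A -> countable (f @` A).
    by apply: sub_countable; exact: card_image_le.
  have cL : countable L.
    apply: bigcup_countable => // m _; apply: finite_set_countable.
    by have [] := HD m.
  have cU (A B : set R) : countable A -> countable B -> countable (A `|` B).
    move=> cA cB; rewrite -bigcup2E.
    by apply: bigcup_countable => // -[|[|n]] _ //=; exact: countable0.
  apply: (cU); first by apply: (cU); [exact: countable1|exact: cim].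
  by apply: bigcup_countable => // j _; exact: cim.
apply: sub_countable cS; apply: subset_card_le => t xt.
apply: contrapT => St; apply: (cluster_away xu xt).
have t0 : t != 0 by apply/eqP => t0; apply: St; left; left.
have ut c : u c != t by apply/eqP => ct; apply: St; left; right; exists c.
have lt r j : L r -> lim (along y r @ \oo) * j.+1%:R^-1 != t.
  by move=> Lr; apply/eqP => rt; apply: St; right; exists j => //; exists r.
have e0 : 0 < `|t| / 2 by rewrite divr_gt0// normr_gt0.
have [m me] : exists m : nat, m.+1%:R^-1 < `|t| / 2.
  exists (Num.truncn (`|t| / 2)^-1).
  by rewrite invf_plt ?posrE// truncnS_gt.
have [Dm Fm] := HD m.
(* If [|u (p, j)| > |t| / 2], then [M / (j + 1)] exceeds [|t| / 2] too, which bounds [j]. *)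
pose J := Num.truncn (M / (`|t| / 2)).
pose layer j := [set c : (nat * int) * nat | c.2 = j].
pose F := [set p | m.+1%:R^-1 < `|y p|] `\` \bigcup_(r in D m) line r.
(* The pieces are the small values and, in each remaining layer, a finite set and finitely many
   lines. *)
apply: (@away_sub _ _ _ _ _ ([set c | `|u c| <= `|t| / 2] `|`
  \bigcup_(j in `I_J.+1) (F `*` [set j] `|`
    \bigcup_(r in D m) (line r `*` [set j])))).
  move=> [p j] _; have [uc|uc] := leP `|u (p, j)| (`|t| / 2); first by left.
  have j1 : 0 < j.+1%:R :> R by [].
  move: uc; rewrite /u/= normrM normfV (gtr0_norm j1) => uc.
  right; exists j.
    have jM : j.+1%:R <= M / (`|t| / 2).
      rewrite ler_pdivlMr//; apply/ltW; rewrite mulrC -ltr_pdivlMr//.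
      by apply: lt_le_trans uc _; rewrite ler_pM2r// invr_gt0.
    by rewrite /= ltnS ltnW// truncn_gt_nat.
  have my : m.+1%:R^-1 < `|y p|.
    apply: lt_trans me (lt_le_trans uc _).
    by rewrite ler_piMr// invf_le1// ler1n.
  have [[r Dr rp]|nr] := pselect ((\bigcup_(r in D m) line r) p).
    by right; exists r.
  by left.
apply: awayU.
  exists (`|t| / 2) => // c /= uc.
  have := ler_distD (u c) t 0; rewrite !subr0 distrC; lra.
apply: away_bigcup => [|j _]; first exact: finite_II.
apply: awayU.
  by apply: away_finite => //; apply: finite_setX => //; exact: finite_set1.
apply: away_bigcup => // r Dr.
have [e e1 He] : away (fun n => u ((n, Num.floor (n%:R * r)), j)) t setT.
  apply: (@away_cvg _ _ (lim (along y r @ \oo) * j.+1%:R^-1)) => //.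
    have yl : along y r @ \oo --> lim (along y r @ \oo) by exact: JL_along_cvg.
    have wl : (j.+1%:R^-1 : R) @[_ --> \oo] --> (j.+1%:R^-1 : R) by exact: cvg_cst.
    exact: cvgM yl wl.

  by apply: lt; exists m.
exists e => // -[[n k] i] [/= nk ->]; rewrite (nk : k = _).
exact: He.
Qed.

End Clusters.

(** * Maps onto countable types with positive fibres *)

Lemma ideal_restrT (I : set (set nat)) :
  is_ideal I -> is_ideal (ideal_restr I [set: nat]).
Proof.
move=> [IU Isub IT I1].
have inT n : n \in [set: nat] by rewrite inE.
split.
- by move=> _ _ [A IA <-] [B IB <-]; exists (A `|` B) => //; exact: IU.
- move=> A' B BA [A IA AE]; exists (set_val @` B).
    apply: Isub IA => _ [b Bb <-].
    by have : (set_val @^-1` A) b by rewrite AE; exact: BA.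
  apply/seteqP; split=> [b [c Bc /val_inj <-//]|b Bb]; by exists b.
- move=> [A IA AT]; apply: IT; apply: Isub IA => n _.
  by have : (set_val @^-1` A) (SigSub (inT n)) by rewrite AT.
- move=> x; exists [set set_val x]; first exact: I1.
  by apply/seteqP; split=> [y /val_inj|y ->].
Qed.

(** Decoding only enlarges fibres: that of [c] contains the fibre of its code, and numbers that code
    nothing go to [c0]. *)
Lemma positive_fibres_count (I : set (set nat)) (T : countType) (c0 : T)
    (f : nat -> nat) :
  is_ideal I -> (forall k, ~ I (f @^-1` [set k])) ->
  exists phi : nat -> T, forall c, ~ I (phi @^-1` [set c]).
Proof.
move=> [_ Isub _ _] fI; exists (odflt c0 \o unpickle \o f) => c Ic.
by apply: (fI (pickle c)); apply: Isub Ic => n /= ->; rewrite pickleK.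
Qed.

Lemma Baire_positive_fibres (I : set (set nat)) (T : countType) (c0 : T) :
  is_ideal I -> ideal_Baire I ->
  exists phi : nat -> T, forall c, ~ I (phi @^-1` [set c]).
Proof.
move=> hI BI; have [f fI] := Baire_ideal_blocks (rank := id) (fun _ _ => id) hI BI.
exact: positive_fibres_count fI.
Qed.

(** The restriction to all of [nat] is an ideal on a subtype; fibres found there are carried back to
    [nat]. *)
Lemma hereditary_Baire_positive_fibres (I : set (set nat))
    (T : countType) (c0 : T) :
  is_ideal I -> ideal_hereditary_Baire I ->
  exists phi : nat -> T, forall c, ~ I (phi @^-1` [set c]).
Proof.
move=> hI HI; have [_ _ IT _] := hI.
have [f fI] := Baire_ideal_blocks (rank := val) val_inj (ideal_restrT hI) (HI _ IT).
have inT n : n \in [set: nat] by rewrite inE.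
apply: (@positive_fibres_count _ _ c0 (fun n => f (SigSub (inT n)))) => // k Ik.
apply: (fI k); exists ((fun n => f (SigSub (inT n))) @^-1` [set k]) => //.
by apply/seteqP; split=> x /=; rewrite (_ : SigSub _ = x)//; exact: val_inj.
Qed.

(** * Assembling the subspaces *)

Section Spaceable.
Variables (R : realType) (I : set (set nat)) (Q : countType) (w : Q -> R).
Variables (q0 : Q) (C : R) (Z : set (nat * int -> R)).

(** Reduces both halves to counting the cluster points of one product with a nonzero coefficient. *)
Lemma spaceable (phi : nat -> (nat * int) * Q) (S : set (linfty R)) :
  is_ideal I -> (forall c, ~ I (phi @^-1` [set c])) ->
  (forall q, `|w q| <= C) -> w q0 = 1 -> Z (fun=> 0) ->
  (forall a f g, Z f -> Z g -> Z (fun p => a * f p + g p)) ->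
  (forall f, (forall e : R, 0 < e ->
    exists2 g, Z g & forall p, `|f p - g p| <= e) -> Z f) ->
  (forall r : R, Z (\1_(line r))) ->
  (forall (x : linfty R) z p M, (forall n, x n = z (phi n).1 * w (phi n).2) ->
     Z z -> (forall q, `|z q| <= M) -> z p != 0 -> S x) ->
  has_closed_subspace_of_density_continuum (S `|` [set 0]).
Proof.
move=> hI phiI wC w1 Z0 ZD Zc Zl HS.
(* Fibres over [(p, q0)] are nonempty because the empty set is in [I]. *)
have /choice[psi psiK] : forall p, exists n, phi n = (p, q0).
  move=> p; apply: contrapT => H; apply: (phiI (p, q0)).
  have [_ Isub _ _] := hI.
  by apply: Isub (ideal_set0 hI) => n /= pn; apply: H; exists n.
exists (weighted_space w phi psi Z); split.
- exact: weighted_space_submod.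
- exact: weighted_space_closed wC Zc.
- move=> x [xw Zx]; have [x0|x0] := eqVneq x 0; [by right|left].
  have [[p xp]|nx] := pselect (exists p, x (psi p) != 0); last first.
    case/eqP: x0; apply/val_inj/funext => n /=; rewrite xw.
    have -> : x (psi (phi n).1) = 0.
      by apply: contrapT => /eqP h; apply: nx; exists (phi n).1.
    exact: mul0r.
  have /bounded_seqP[M xM] := linftyP x.
  apply: (HS x (x \o psi) p M) => // q; exact: xM.
- exact: weighted_space_density wC w1 psiK Zl.
Qed.

End Spaceable.

Theorem theorem12 (R : realType) (I : set (set nat)) (hI : is_ideal I) :
  (ideal_Baire I ->
     has_closed_subspace_of_density_continuum
       (Lclass R I [set: nat] `|` [set 0])) /\
  (ideal_hereditary_Baire I ->
     has_closed_subspace_of_density_continuum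
       (Lclass R I [set: R] `|` [set 0])).
Proof.
split=> [BI|HI].
  have [phi phiI] :=
    @Baire_positive_fibres I ((nat * int) * nat)%type (0%N, 0, 0%N) hI BI.
  apply: (@spaceable R I nat (fun j => j.+1%:R^-1) 0%N 1 (@JL R) phi) => //.
  - by move=> j; rewrite ger0_norm ?invr_ge0// invf_le1// ler1n.
  - by rewrite invr1.
  - exact: JL0.
  - exact: JLD.
  - exact: JL_closed.
  - exact: JL_line.
  - move=> x z p M xz zJL zM zp; rewrite /Lclass/= card_eq_le; apply/andP; split.
      exact: (JL_cluster_countable hI xz zJL zM).
    exact: (JL_cluster_infinite hI phiI xz zp).
have [phi phiI] :=
  @hereditary_Baire_positive_fibres I ((nat * int) * rat)%type
    (0%N, 0, 0) hI HI.
have pi0 := pi_gt0 R.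
(* The weight maps the rationals densely into the interval from -2 to 2, with value 1 at 1. *)
apply: (@spaceable R I rat (fun q => atan (ratr q) * (4 / pi)) 1 2 setT phi) => //.
- move=> q; have := atan_gtNpi2 (ratr q : R); have := atan_ltpi2 (ratr q : R).
  move=> a b; rewrite mulrA ler_norml ler_pdivrMr// ler_pdivlMr//.
  by apply/andP; split; lra.
- rewrite rmorph1 atan1 mulf_div [X in X / _]mulrC divff//.
  by rewrite mulf_neq0 ?gt_eqF.
- move=> x z p M xz _ _ zp; rewrite /Lclass/= card_eq_le; apply/andP; split.
    exact: card_leT.
  (* By continuity and density of the rationals, each [h t] is a limit of values taken on whole
     fibres, hence a cluster point. *)
  pose h (t : R) := z p * (atan t * (4 / pi)).
  apply: (@inj_card_leT _ _ h) => [s t|t].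
    move=> /(mulfI zp)/mulIf; rewrite mulf_neq0 ?invr_eq0 ?gt_eqF// => /(_ isT).
    exact: (can_inj (@atanK R)).
  pose u c : R := z c.1 * (atan (ratr c.2) * (4 / pi)).
  apply: (cluster_fibre hI (u := u) phiI) => // e e0.
  have hc : h s @[s --> t] --> h t.
    have ct : atan s @[s --> t] --> atan t by exact: continuous_atan.
    exact: cvgM (cvg_cst _) (cvgM ct (cvg_cst _)).
  have /cvgrPdist_lt/(_ _ e0)/nbhs_ballP[d d0 Hd] := hc.
  have [||s [ts [q _ qs]]] := @dense_rat R (ball t d).
  - by exists t; exact: ballxx.
  - exact: ball_open.
  by exists (p, q); rewrite distrC /u/= qs; exact: Hd.
Qed.
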